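(* Let $\mathrm{MDP}_{\mathbb M}$ and $\mathrm{MDP}_{\mathbb S}$ be as in the context. For any randomized stationary policy $\mu$, $$R^{\mathbb M}_{\mu}=\frac{1}{\bar{\alpha}^{\mathbb S}_{\mu}+1},$$ where $R^{\mathbb M}_\mu$ is the probability of reaching a goal state from $\mathbf{x}_0$ under $\mu$ in $\mathrm{MDP}_{\mathbb M}$ and $\bar\alpha^{\mathbb S}_\mu$ is the expected total cost of $\mu$ from $\mathbf{x}_0$ in $\mathrm{MDP}_{\mathbb S}$ (with the convention $1/(\infty+1)=0$).
   Context: **The original MDP ($\mathrm{MDP}_{\mathbb M}$).** It has finite state space $\mathbb{X}_{\mathbb M}$, finite action space $\mathbb{U}$, transition probabilities $p_{\mathbb M}(\mathbf{j}|\mathbf{x},u)$, a set of goal states $\mathbb{X}_G\subseteq\mathbb{X}_{\mathbb M}$, a set of unsafe states $\mathbb{X}_U\subseteq\mathbb{X}_{\mathbb M}$ disjoint from $\mathbb{X}_G$, and an initial state $\mathbf{x}_0\in\mathbb{X}_{\mathbb M}\setminus\mathbb{X}_G$. Unsafe states are absorbing (there is only one control, a self-transition with probability 1). A state is *safe* if it is not unsafe. It is assumed that from every safe state there is at least one sequence of (feasible) actions that can reach one of the states in $\mathbb{X}_G$ with positive probability. **The SSP MDP ($\mathrm{MDP}_{\mathbb S}$).** Its state space is $\mathbb{X}_{\mathbb S}=(\mathbb{X}_{\mathbb M}\setminus\mathbb{X}_G)\cup\{\mathbf{x}^*\}$, where $\mathbf{x}^*$ is a special termination state, and its action space is $\mathbb{U}$.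 Its transition probabilities are: for $\mathbf{x}\in\mathbb{X}_{\mathbb M}\setminus(\mathbb{X}_G\cup\mathbb{X}_U)$ and $u\in\mathbb{U}$, $$p_{\mathbb S}(\mathbf{j}|\mathbf{x},u)=\begin{cases}\sum_{\mathbf{i}\in\mathbb{X}_G}p_{\mathbb M}(\mathbf{i}|\mathbf{x},u), & \mathbf{j}=\mathbf{x}^*,\\ p_{\mathbb M}(\mathbf{j}|\mathbf{x},u), & \mathbf{j}\in\mathbb{X}_{\mathbb M}\setminus\mathbb{X}_G;\end{cases}$$ moreover, for all $u\in\mathbb{U}$, $p_{\mathbb S}(\mathbf{x}^*|\mathbf{x}^*,u)=1$, and $p_{\mathbb S}(\mathbf{x}_0|\mathbf{x},u)=1$ if $\mathbf{x}\in\mathbb{X}_U$. The one-step cost is $g(\mathbf{x},u)=1$ if $\mathbf{x}\in\mathbb{X}_U$ and $g(\mathbf{x},u)=0$ for all other $\mathbf{x}\in\mathbb{X}_{\mathbb S}$. **Policies.** A randomized stationary policy (RSP) $\mu$ applies action $u$ at state $\mathbf{x}$ with probability $\mu(u|\mathbf{x})$. Standing assumption on RSPs: $\mu(u|\mathbf{x})>0$ if $u$ is feasible at $\mathbf{x}$, and $\mu(u|\mathbf{x})=0$ otherwise. A policy $\mu$ on $\mathrm{MDP}_{\mathbb S}$ is identified with the policy on $\mathrm{MDP}_{\mathbb M}$ that is the same on all states in $\mathbb{X}_{\mathbb M}\setminus(\mathbb{X}_G\cup\mathbb{X}_U)$ (actions at goal and unsafe states are irrelevant). **Quantities.** $\bar\alpha^{\mathbb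 S}_\mu=\lim_{t\to\infty}E\{\sum_{k=0}^{t-1}g(\mathbf{x}_k,u_k)\,|\,\mathbf{x}_0\}$, with actions $u_k$ generated by $\mu$ in $\mathrm{MDP}_{\mathbb S}$. $R^{\mathbb M}_\mu$ is the probability of reaching one of the goal states from $\mathbf{x}_0$ under $\mu$ on $\mathrm{MDP}_{\mathbb M}$. *)

(* Defs.v *)
From HB Require Import structures.
From mathcomp Require Import all_boot all_order all_algebra.
From mathcomp Require Import all_classical all_reals all_analysis.

Set Implicit Arguments.
Unset Strict Implicit.
Unset Printing Implicit Defensive.

Import Order.TTheory GRing.Theory Num.Theory.

Local Open Scope ring_scope.

(* [avail M x] is the set of actions feasible at [x]; the values of
   [trans M x u] for [u] infeasible at [x] are junk. *)
Record mdp (R : realType) (X U : finType) := Mdp {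
  avail : X -> {set U};
  trans : X -> U -> X -> R;
  avail_neq0 : forall x, avail x != finset.set0;
  trans_ge0 : forall x u y, u \in avail x -> 0 <= trans x u y;
  trans_sum1 : forall x u, u \in avail x -> \sum_y trans x u y = 1 }.

Definition absorbing (R : realType) (X U : finType) (M : mdp R X U) (x : X) :=
  exists2 u, avail M x = [set u]%SET & trans M x u x = 1.

(* Probability that, starting from [x], the run that applies the actions [us]
   in order visits [G]; a run in which the next action is infeasible at the
   current state is counted as not visiting [G] from then on. *)
Fixpoint plan_reach (R : realType) (X U : finType) (M : mdp R X U)
    (G : {set X}) (us : seq U) (x : X) : R :=
  if x \in G then 1 else
  match us with
  | [::] => 0
  | u :: us' =>
      if u \in avail M x then \sum_y trans M x u y * plan_reach M G us' y else 0
  end.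

(* Randomized stationary policies [mu x u] = mu(u|x) whose support at each state
   is exactly the set of feasible actions. *)
Record is_rsp (R : realType) (X U : finType) (M : mdp R X U)
    (mu : X -> U -> R) : Prop := IsRsp {
  rsp_sum1 : forall x, \sum_u mu x u = 1;
  rsp_gt0 : forall x u, u \in avail M x -> 0 < mu x u;
  rsp_eq0 : forall x u, u \notin avail M x -> mu x u = 0 }.

(* [Xs k], [Us k] are the state and the action at time [k] of the run of [M]
   from [x0] under [mu], realized on the probability space (T, P): the law of
   (x_0, u_0, x_1, u_1, ..., u_(n-1), x_n) is given by the product formula. *)
Record is_run (R : realType) (X U : finType) (M : mdp R X U) (mu : X -> U -> R)
    (x0 : X) (d : measure_display) (T : measurableType d) (P : probability T R)
    (Xs : nat -> T -> X) (Us : nat -> T -> U) : Prop := IsRun {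
  run_measurable_state : forall k x, measurable [set w | Xs k w = x]%classic;
  run_measurable_action : forall k u, measurable [set w | Us k w = u]%classic;
  run_law : forall (n : nat) (xs : nat -> X) (us : nat -> U),
    P [set w | (forall k, (k <= n)%N -> Xs k w = xs k) /\
               (forall k, (k < n)%N -> Us k w = us k)]%classic
    = ((xs 0%N == x0)%:R *
       \prod_(k < n) (mu (xs k) (us k) * trans M (xs k) (us k) (xs k.+1)))%:E }.

Definition reach_prob (R : realType) (X : finType) (d : measure_display)
    (T : measurableType d) (P : probability T R) (Xs : nat -> T -> X)
    (G : {set X}) : \bar R :=
  P [set w | exists k, Xs k w \in G]%classic.

Definition total_cost (R : realType) (X U : finType) (d : measure_display)
    (T : measurableType d) (P : probability T R) (Xs : nat -> T -> X)
    (Us : nat -> T -> U) (g : X -> U -> R) : \bar R :=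
  limn (fun t : nat => 'E_P[fun w => (\sum_(k < t) g (Xs k w) (Us k w))%R])%E.

(* [None] is the termination state x^*. *)
Notation ssp_state G := (option {x | x \notin G}).

Section SspMdp.
Variables (R : realType) (X U : finType) (M : mdp R X U) (G B : {set X}).
Variable x0 : {x : X | x \notin G}.

Definition ssp_avail (x : ssp_state G) : {set U} :=
  match x with
  | Some x' => if val x' \in B then finset.setT else avail M (val x')
  | None => finset.setT
  end.

Definition ssp_trans (x : ssp_state G) (u : U) (j : ssp_state G) : R :=
  match x with
  | None => (j == None)%:R
  | Some x' =>
      if val x' \in B then (j == Some x0)%:R
      else match j with
           | None => \sum_(i in G) trans M (val x') u i
           | Some j' => trans M (val x') u (val j')
           end
  end.

Lemma ssp_avail_neq0 x : ssp_avail x != finset.set0.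
Proof.
have /finset.set0Pn[u _] := avail_neq0 M (val x0).
have T0 : [set: U]%SET != finset.set0 by apply/finset.set0Pn; exists u; rewrite finset.inE.
by case: x => [x|] //=; case: ifP => // _; apply: avail_neq0.
Qed.

Lemma ssp_trans_ge0 x u j : u \in ssp_avail x -> 0 <= ssp_trans x u j.
Proof.
case: x => [x|] /=; last by rewrite ler0n.
case: ifP => _ ux; first by rewrite ler0n.
by case: j => [j|]; [|apply: sumr_ge0 => i _]; apply: trans_ge0.
Qed.

Lemma ssp_trans_sum1 x u : u \in ssp_avail x -> \sum_j ssp_trans x u j = 1.
Proof.
have dirac1 (a : ssp_state G) : \sum_j (j == a)%:R = 1 :> R.
  by rewrite (bigD1 a) //= eqxx big1 ?addr0 // => j /negPf ->.
case: x => [x|] /=; last by rewrite dirac1.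
case: ifP => _ ux; first by rewrite dirac1.
rewrite -(trans_sum1 ux) (bigID (mem G) predT) /= (bigD1 None) //=; congr (_ + _).
rewrite [RHS](big_sub [pred y | y \notin G]).
rewrite (reindex_omap (Some : {y | y \notin G} -> ssp_state G) id) /=.
  by apply: eq_big => // j; rewrite eqxx.
by case.
Qed.

Definition ssp : mdp R (ssp_state G) U :=
  Mdp ssp_avail_neq0 ssp_trans_ge0 ssp_trans_sum1.

End SspMdp.

Definition ssp_cost (R : realType) (X U : finType) (G B : {set X})
    (x : ssp_state G) (u : U) : R :=
  match x with
  | Some x' => (val x' \in B)%:R
  | None => 0
  end.

Arguments ssp_cost R {X} U {G} B x u.

(* The identification of policies on [ssp M B x0] with policies on [M]: they
   coincide at the states that are neither goal nor unsafe. *)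
Definition same_policy (R : realType) (X U : finType) (G B : {set X})
    (muS : ssp_state G -> U -> R) (muM : X -> U -> R) : Prop :=
  forall (x : {x : X | x \notin G}) (u : U),
    val x \notin B -> muS (Some x) u = muM (val x) u.

(* Main.v *)
(* Let [w x] be the probability that the run of [M] from [x] never visits [G],
   and [r = 1 - w x0]. On the SSP, the function [h] equal to [1 - w] on
   nonterminal states and to [1] at [x^*] is harmonic except at unsafe states,
   where [h = 0] and the restart moves its mean to [r]. Hence, with [c_t] the
   expected cost of the first [t] steps, [E h(x_t) = r (1 + c_t)]. If [x0] is
   safe, every state of the SSP reaches [x^*] with positive probability, so the
   finite chain is absorbed at [x^*] almost surely, [E h(x_t)] tends to [1], and
   [r (1 + alpha) = 1]. If [x0] is unsafe, then [r = 0] and [c_t = t]. *)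

Require Import Defs.
From HB Require Import structures.
From mathcomp Require Import all_boot all_order all_algebra.
From mathcomp Require Import all_classical all_reals all_analysis.
From mathcomp Require Import measurable_realfun.

Set Implicit Arguments.
Unset Strict Implicit.
Unset Printing Implicit Defensive.

Import Order.TTheory GRing.Theory Num.Theory.
Import numFieldNormedType.Exports.

Local Open Scope ring_scope.

(** * Nonnegative kernels on a finite set, acting on functions *)

Section Kernels.
Variables (R : realType) (S : finType).
Implicit Types (K : S -> S -> R) (f g : S -> R) (x y : S).

Definition kernel_op K f x : R := \sum_y K x y * f y.

(** The restriction bears on the source of a step, so [n] iterations keep the paths whose states at
    times [0] to [n - 1] lie in [D] and leave the state at time [n] free. *)
Definition taboo_kernel (D : {set S}) K x y : R := (x \in D)%:R * K x y.

Definition point_mass y x : R := (y == x)%:R.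

Lemma sum_point_mass f x : \sum_y point_mass y x * f y = f x.
Proof.
rewrite (bigD1 x) //= /point_mass eqxx mul1r big1 ?addr0 // => y /negPf yx.
by rewrite yx mul0r.
Qed.

Lemma kernel_op_point_mass K x y : kernel_op K (point_mass y) x = K x y.
Proof.
rewrite /kernel_op -[RHS](sum_point_mass (K x) y).
by apply: eq_bigr => z _; rewrite mulrC /point_mass eq_sym.
Qed.

(** The iterates of [point_mass y] at [x] are the [(x, y)] entries of the [n]-th power of [K];
    linearity in [f] is read off from this form. *)
Lemma iter_kernel_opE K n f x :
  iter n (kernel_op K) f x =
  \sum_y iter n (kernel_op K) (point_mass y) x * f y.
Proof.
elim: n x => [|n IH] x /=; first by rewrite sum_point_mass.
rewrite -[LHS]/(\sum_z K x z * iter n (kernel_op K) f z).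
under [LHS]eq_bigr do rewrite IH mulr_sumr.
rewrite exchange_big /=; apply: eq_bigr => y _.
rewrite -[in RHS]/(\sum_z K x z * iter n (kernel_op K) (point_mass y) z).
by rewrite mulr_suml; apply: eq_bigr => z _; rewrite mulrA.
Qed.

Lemma iter_kernel_op_sum K n (D : {set S}) x :
  iter n (kernel_op K) (fun y => (y \in D)%:R) x =
  \sum_(y in D) iter n (kernel_op K) (point_mass y) x.
Proof.
rewrite iter_kernel_opE [RHS]big_mkcond; apply: eq_bigr => y _.
by case: ifP; rewrite ?mulr1 ?mulr0.
Qed.

Lemma iter_kernel_op_linear K n (a : R) f g x :
  iter n (kernel_op K) (fun y => f y + a * g y) x =
  iter n (kernel_op K) f x + a * iter n (kernel_op K) g x.
Proof.
rewrite !(iter_kernel_opE _ _ _ x) mulr_sumr -big_split.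
by apply: eq_bigr => y _; rewrite /= mulrDr mulrCA.
Qed.

Lemma iter_kernel_opZ K n (a : R) g x :
  iter n (kernel_op K) (fun y => a * g y) x = a * iter n (kernel_op K) g x.
Proof.
rewrite !(iter_kernel_opE _ _ _ x) mulr_sumr.
by apply: eq_bigr => y _; rewrite mulrCA.
Qed.

Lemma kernel_op_le K f g x : (forall y, 0 <= K x y) ->
  (forall y, f y <= g y) -> kernel_op K f x <= kernel_op K g x.
Proof. by move=> K0 fg; apply: ler_sum => y _; rewrite ler_wpM2l. Qed.

Lemma iter_kernel_op_le K n f g x : (forall x y, 0 <= K x y) ->
  (forall y, f y <= g y) -> iter n (kernel_op K) f x <= iter n (kernel_op K) g x.
Proof.
by move=> K0 fg; elim: n x => [|n IH] x //=; apply: kernel_op_le.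
Qed.

Lemma iter_kernel_op_ge0 K n f x : (forall x y, 0 <= K x y) ->
  (forall y, 0 <= f y) -> 0 <= iter n (kernel_op K) f x.
Proof.
move=> K0 f0; elim: n x => [|n IH] x //=.
by apply: sumr_ge0 => y _; rewrite mulr_ge0.
Qed.

Lemma iter_kernel_op_decr K f x : (forall x y, 0 <= K x y) ->
  (forall y, kernel_op K f y <= f y) ->
  nonincreasing_seq (fun n => iter n (kernel_op K) f x).
Proof.
move=> K0 Kf; apply/nonincreasing_seqP => n.
by rewrite iterSr; apply: iter_kernel_op_le.
Qed.

Lemma iter_kernel_op_cvg K f x : (forall x y, 0 <= K x y) ->
  (forall y, kernel_op K f y <= f y) -> (forall y, 0 <= f y) ->
  cvgn (fun n => iter n (kernel_op K) f x).
Proof.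
move=> K0 Kf f0; apply: nonincreasing_is_cvgn; first exact: iter_kernel_op_decr.
by exists 0 => _ [n _ <-]; apply: iter_kernel_op_ge0.
Qed.

(** The iterates decrease and are bounded below, hence converge; a finite sum commutes with limits,
    and shifting the index does not change the limit. *)
Lemma kernel_op_limn K f x : (forall x y, 0 <= K x y) ->
  (forall y, kernel_op K f y <= f y) -> (forall y, 0 <= f y) ->
  kernel_op K (fun y => limn (fun n => iter n (kernel_op K) f y)) x =
  limn (fun n => iter n (kernel_op K) f x).
Proof.
move=> K0 Kf f0; apply/esym/cvg_lim => //; rewrite -cvg_shiftS /=.
rewrite /kernel_op; apply: (@cvg_big _ _ +%R) => [|y _]; first exact: add_continuous.
by apply: cvgMl_tmp; apply: iter_kernel_op_cvg.
Qed.

(** * Stochastic kernels and almost sure absorption *)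

Section Stochastic.
Variable K : S -> S -> R.
Hypothesis K_ge0 : forall x y, 0 <= K x y.
Hypothesis K_sum1 : forall x, \sum_y K x y = 1.

Lemma kernel_op_le1 f x : (forall y, f y <= 1) -> kernel_op K f x <= 1.
Proof.
move=> f1; rewrite -(K_sum1 x); apply: ler_sum => y _.
by rewrite ler_piMr.
Qed.

Lemma iter_kernel_op1 n x : iter n (kernel_op K) (fun=> 1) x = 1.
Proof.
elim: n x => [|n IH] x //=; rewrite /kernel_op -[RHS](K_sum1 x).
by apply: eq_bigr => y _; rewrite IH mulr1.
Qed.

(** The row at [x] is nonnegative with total mass 1, so an entry 1 at [z] leaves nothing for the
    others. *)
Lemma kernel_op_dirac f x z : K x z = 1 -> kernel_op K f x = f z.
Proof.
move=> Kxz; have K0 y : y != z -> K x y = 0.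
  move: (K_sum1 x); rewrite (bigD1 z) //= Kxz -[RHS]addr0 => /addrI/eqP.
  by rewrite psumr_eq0// => /allP h yz; have /eqP := implyP (h y (mem_index_enum y)) yz.
rewrite /kernel_op (bigD1 z) //= Kxz mul1r big1 ?addr0// => y yz.
by rewrite K0 ?mul0r.
Qed.

(* With [u_n x] the probability of not being absorbed within [n] steps and [N]
   such that [u_N <= rho * u_0] for some [rho < 1], we get
   [u_(N + n) <= rho * u_n], so that the limit [l] satisfies [l <= rho * l]. *)
Lemma absorption_cvg (a : S) (u := fun x => (x != a)%:R : R) x : K a a = 1 ->
  (forall x, exists n, iter n (kernel_op K) u x < 1) ->
  (iter n (kernel_op K) u x @[n --> \oo] --> 0)%classic.
Proof.
move=> Kaa /choice[n_ n_lt1].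
have u0 y : 0 <= u y by rewrite /u ler0n.
have u1 y : u y <= 1 by rewrite /u lern1 leq_b1.
have ua n : iter n (kernel_op K) u a = 0.
  elim: n => [|n IH] /=; first by rewrite /u eqxx.
  by rewrite (kernel_op_dirac _ Kaa).
have uP y : kernel_op K u y <= u y.
  rewrite {2}/u; have [->|_] := eqVneq y a; first by rewrite [kernel_op K u a](ua 1%N).
  exact: kernel_op_le1.
(* Survival probabilities do not increase with the horizon, so the largest of the finitely many
   [n_ y] serves all states at once. *)
pose N := (\max_y n_ y)%N.
pose rho : R := \big[Num.max/0]_y iter N (kernel_op K) u y.
have rho_lt1 : rho < 1.
  apply/bigmax_ltP; split=> // y _; apply: le_lt_trans (n_lt1 y).
  by apply: iter_kernel_op_decr => //; apply: leq_bigmax.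
have rhoP y : iter N (kernel_op K) u y <= rho * u y.
  rewrite /u; have [->|_] := eqVneq y a; first by rewrite ua mulr0.
  by rewrite mulr1; apply: le_bigmax.
have cu := iter_kernel_op_cvg (x := x) K_ge0 uP u0.
set l : R := limn (fun n => iter n (kernel_op K) u x).
have l0 : 0 <= l by apply: limr_ge => //; apply: nearW => n; apply: iter_kernel_op_ge0.
suff : l <= rho * l.
  rewrite -subr_ge0 -{2}[l]mul1r -mulrBl => h.
  suff <- : l = 0 by [].
  apply/eqP; rewrite eq_le l0 andbT leNgt; apply/negP => lp.
  by move: h; rewrite pmulr_lge0// subr_ge0 leNgt rho_lt1.
have cN : (iter (n + N) (kernel_op K) u x @[n --> \oo] --> l)%classic.
  by rewrite (cvg_shiftn N (fun n => iter n (kernel_op K) u x) (nbhs l)).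
apply: (ler_cvg_to cN (cvgMl_tmp (a := rho) cu)).
apply: nearW => n; rewrite iterD -iter_kernel_opZ.
exact: iter_kernel_op_le.
Qed.

End Stochastic.

End Kernels.

Arguments point_mass {R S} y x.

(** * From the law of a run to iterates of its kernel *)

Section Runs.
Variables (d : measure_display) (T : measurableType d) (R : realType).
Variable (P : probability T R).
Local Open Scope classical_set_scope.

Lemma measurable_forall (C : pred nat) (A : nat -> set T) :
  (forall j, measurable (A j)) ->
  measurable [set w | forall j, C j -> A j w].
Proof.
by move=> mA; apply: bigcap_measurableType.
Qed.

Lemma measurable_fiber_pred (I : finType) (Z : T -> I) (D : pred I) :
  (forall i, measurable [set w | Z w = i]) -> measurable [set w | D (Z w)].
Proof.
move=> mZ.
have -> : [set w | D (Z w)] = \bigcup_(i in [set` D]) [set w | Z w = i].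
  apply/seteqP; split=> w /=; first by move=> Dw; exists (Z w).
  by case=> i Di /= ->.
by apply: fin_bigcup_measurable => //; exact: finite_finset.
Qed.

Lemma prob_fiber_sum (I : finType) (Z : T -> I) (F : set T) (D : pred I) :
  measurable F -> (forall i, measurable [set w | Z w = i]) ->
  P (F `&` [set w | D (Z w)]) =
  (\sum_(i | D i) P (F `&` [set w | Z w = i]))%E.
Proof.
move=> mF mZ.
rewrite (@bigfs _ _ _ I) ?index_enum_uniq//; last by move=> i _; rewrite mem_index_enum.
rewrite -measure_fin_bigcup.
- rewrite -setI_bigcupr; congr (P (_ `&` _)).
  apply/seteqP; split=> w /=; first by move=> Dw; exists (Z w).
  by case=> i Di /= ->.
- exact: finite_finset.
- by move=> i j _ _ [w [[_ /= <-] [_ /= <-]]].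
- by move=> i _; apply: measurableI.
Qed.


(** Under a stationary policy the states form a Markov chain; this is its transition matrix. *)
Definition step_kernel (X U : finType) (M : mdp R X U) (mu : X -> U -> R) x y : R :=
  \sum_u mu x u * trans M x u y.

Section Law.
Variables (X U : finType) (M : mdp R X U) (mu : X -> U -> R) (x0 : X).
Variables (Xs : nat -> T -> X) (Us : nat -> T -> U).
Hypothesis run : is_run M mu x0 P Xs Us.
Variable D : {set X}.
Let K := taboo_kernel D (step_kernel M mu).

(** The indices [m] and [k] agree except inside the induction step, where time [k] is for a moment
    neither constrained to [D] nor pinned. *)
Let tail_event m k n (xs : nat -> X) (us : nat -> U) : set T :=
  [set w | forall j, (j < m)%N -> Xs j w \in D] `&`
  ([set w | forall j, (k <= j <= n)%N -> Xs j w = xs j] `&`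
   [set w | forall j, (k <= j < n)%N -> Us j w = us j]).

Let measurable_tail_event m k n xs us : measurable (tail_event m k n xs us).
Proof.
apply: measurableI; last apply: measurableI.
- apply: (@measurable_forall (fun j => (j < m)%N) (fun j => [set w | Xs j w \in D])) => j.
  exact/measurable_fiber_pred/(run_measurable_state run).
- apply: (@measurable_forall (fun j => (k <= j <= n)%N) (fun j => [set w | Xs j w = xs j])) => j.
  exact: run_measurable_state run j _.
- apply: (@measurable_forall (fun j => (k <= j < n)%N) (fun j => [set w | Us j w = us j])) => j.
  exact: run_measurable_action run j _.
Qed.

(* The path is unpinned one coordinate at a time, from the left: the step sums
   over the state and the action at time [k]. *)
Let prob_tail_event k n xs us : (k <= n)%N ->
  P (tail_event k k n xs us) =
  (iter k (kernel_op K) (point_mass (xs k)) x0 *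
   \prod_(k <= j < n) (mu (xs j) (us j) * trans M (xs j) (us j) (xs j.+1)))%:E.
Proof.
elim: k xs us => [|k IH] xs us kn.
  rewrite /= /point_mass big_mkord -(run_law run); congr (P _).
  apply/seteqP; split=> w /=.
    by case=> _ [hx hu]; split=> j jn; [apply: hx|apply: hu].
  by case=> hx hu; split.
(* Overwriting time [k] with the pair [p] turns the event pinned at that time into an instance of
   the induction hypothesis. *)
pose xs' (p : X * U) j := if j == k then p.1 else xs j.
pose us' (p : X * U) j := if j == k then p.2 else us j.
have -> : tail_event k.+1 k.+1 n xs us =
    tail_event k k.+1 n xs us `&` [set w | (Xs k w, Us k w).1 \in D].
  apply/seteqP; split=> w /=.
    case=> hD h; split; last exact: hD.
    by split=> // j jk; apply: hD; rewrite ltnS ltnW.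
  case=> -[hD h] hk; split=> // j; rewrite ltnS leq_eqVlt => /predU1P[->//|].
  exact: hD.
rewrite (@prob_fiber_sum _ (fun w => (Xs k w, Us k w)) _ (fun p => p.1 \in D)) //; last first.
  move=> [x u].
  have -> : [set w | (Xs k w, Us k w) = (x, u)] =
      [set w | Xs k w = x] `&` [set w | Us k w = u].
    by apply/seteqP; split=> w /= => [[-> ->]|[-> ->]].
  by apply: measurableI; [exact: run_measurable_state run _ _|exact: run_measurable_action run _ _].
have E (p : X * U) : P (tail_event k k.+1 n xs us `&` [set w | (Xs k w, Us k w) = p]) =
   (iter k (kernel_op K) (point_mass p.1) x0 *
    (mu p.1 p.2 * trans M p.1 p.2 (xs k.+1)) *
    \prod_(k.+1 <= j < n) (mu (xs j) (us j) * trans M (xs j) (us j) (xs j.+1)))%:E.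
  have -> : tail_event k k.+1 n xs us `&` [set w | (Xs k w, Us k w) = p] =
      tail_event k k n (xs' p) (us' p).
    rewrite /xs' /us'; apply/seteqP; split=> w /=.
      case=> -[hD [hx hu]] <-; split=> //; split=> j /andP[kj jn].
        case: eqP => [->//|/eqP jk]; apply: hx; rewrite jn andbT.
        by rewrite ltn_neqAle eq_sym jk.
      case: eqP => [->//|/eqP jk]; apply: hu; rewrite jn andbT.
      by rewrite ltn_neqAle eq_sym jk.
    case=> hD [hx hu]; split; last first.
      have := hx k; have := hu k; rewrite leqnn kn ltnW// eqxx.
      by move=> /(_ isT) -> /(_ isT) ->; case: (p).
    split=> //; split=> j /andP[kj jn].
      by have := hx j; rewrite jn ltnW//= => /(_ isT); rewrite gtn_eqF.
    by have := hu j; rewrite jn ltnW//= => /(_ isT); rewrite gtn_eqF.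
  rewrite IH ?(ltnW kn)// (big_ltn kn) mulrA /xs' /us' eqxx gtn_eqF//.
  congr (_ * _)%:E; apply: eq_big_nat => j /andP[kj _].
  by rewrite !gtn_eqF// ltnW.
rewrite (eq_bigr _ (fun p _ => E p)).
rewrite sumEFin -mulr_suml iterSr; congr ((_ * _)%:E).
transitivity (\sum_(x in D) \sum_u iter k (kernel_op K) (point_mass x) x0 *
    (mu x u * trans M x u (xs k.+1))).
  by rewrite pair_big_dep; apply: eq_bigl => p; rewrite andbT.
(* Summing over the actions produces [step_kernel], and the condition that the state at time [k]
   lies in [D] becomes the taboo factor. *)
rewrite [RHS]iter_kernel_opE [LHS]big_mkcond; apply: eq_bigr => x _.
rewrite kernel_op_point_mass -mulr_sumr /K /taboo_kernel.
by case: ifP; rewrite ?mul1r// mul0r mulr0.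
Qed.

Lemma taboo_prob n (A : {set X}) :
  P [set w | (forall j, (j < n)%N -> Xs j w \in D) /\ Xs n w \in A] =
  (iter n (kernel_op K) (fun x => (x \in A)%:R) x0)%:E.
Proof.
pose F := [set w | forall j, (j < n)%N -> Xs j w \in D].
have mF : measurable F.
  apply: (@measurable_forall (fun j => (j < n)%N) (fun j => [set w | Xs j w \in D])) => j.
  exact/measurable_fiber_pred/(run_measurable_state run).
(* The action is a mere filler: with [k = n] no action is pinned and the product is empty. *)
have [u0 _] := finset.set0Pn _ (avail_neq0 M x0).
rewrite (@prob_fiber_sum _ (Xs n) F (fun x => x \in A))//; last first.
  exact: (run_measurable_state run).
rewrite iter_kernel_op_sum -sumEFin; apply: eq_bigr => x _.
have := @prob_tail_event n n (fun=> x) (fun=> u0) (leqnn n).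
rewrite big_geq// mulr1 => <-; congr (P _).
apply/seteqP; split=> w /=.
  case=> hF hx; split=> //; split=> j; last by rewrite leqNgt andNb.
  by rewrite -eqn_leq => /eqP <-.
by case=> hF [hx _]; split=> //; apply: hx; rewrite leqnn.
Qed.

End Law.

Section Observables.
Variables (X U : finType) (M : mdp R X U) (mu : X -> U -> R) (x0 : X).
Variables (Xs : nat -> T -> X) (Us : nat -> T -> U).
Hypothesis run : is_run M mu x0 P Xs Us.
Let K := step_kernel M mu.

(** The events of hitting [G] by time [n] increase to the event of ever hitting it, and the
    complement of each is a taboo event. *)
Lemma reach_prob_cvg (G : {set X}) :
  (1 - iter n (kernel_op (taboo_kernel (~: G) K)) (fun x => (x \in (~: G)%SET)%:R) x0)%:E
    @[n --> \oo] --> reach_prob P Xs G.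
Proof.
pose hit n := [set w | exists2 k, (k <= n)%N & Xs k w \in G].
have hitE n : hit n = ~` [set w | (forall j, (j < n)%N -> Xs j w \in (~: G)%SET) /\
                                  Xs n w \in (~: G)%SET].
  apply/seteqP; split=> w /=.
    case=> k; rewrite leq_eqVlt => /predU1P[->|kn] XG [hD hn].
      by move: hn; rewrite finset.inE XG.
    by have := hD k kn; rewrite finset.inE XG.
  move=> nh; apply: contrapT => hn; apply: nh.
  have notin k : (k <= n)%N -> Xs k w \in (~: G)%SET.
    by move=> kn; rewrite finset.inE; apply/negP => XG; apply: hn; exists k.
  by split=> [j /ltnW|]; apply: notin.
have mavoid n : measurable [set w | (forall j, (j < n)%N -> Xs j w \in (~: G)%SET) /\
                                  Xs n w \in (~: G)%SET].
  apply: measurableI; last exact/measurable_fiber_pred/(run_measurable_state run).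
  apply: (@measurable_forall (fun j => (j < n)%N) (fun j => [set w | Xs j w \in (~: G)%SET])) => j.
  exact/measurable_fiber_pred/(run_measurable_state run).
have -> : (fun n => (1 - iter n (kernel_op (taboo_kernel (~: G) K))
    (fun x => (x \in (~: G)%SET)%:R) x0)%:E) = P \o hit.
  by apply/funext => n /=; rewrite hitE probability_setC// (taboo_prob run).
rewrite /reach_prob.
have -> : [set w | exists k, Xs k w \in G] = \bigcup_n hit n.
  apply/seteqP; split=> w /=; first by case=> k XG; exists k => //; exists k.
  by case=> n _ [k _ XG]; exists k.
have mhit n : measurable (hit n) by rewrite hitE; exact: measurableC.
apply: nondecreasing_cvg_mu => //; first exact: bigcup_measurable.
move=> m n mn; apply/subsetPset => w [k km XG].
by exists k => //; apply: leq_trans mn.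
Qed.

(** Linearity of the integral reduces this to one time [k], where [taboo_prob] applies with the full
    state space in place of the taboo set. *)
Lemma expected_visits (A : {set X}) t :
  ('E_P[fun w => (\sum_(k < t) (Xs k w \in A)%:R)%R])%E =
  (\sum_(k < t) iter k (kernel_op K) (fun x => (x \in A)%:R) x0)%:E.
Proof.
have indicE k : (fun w => (Xs k w \in A)%:R : R) = \1_[set w | Xs k w \in A].
  apply/funext => w; rewrite indicE; congr (_%:R); congr nat_of_bool.
  by apply/idP/idP; rewrite inE.
have mA k : measurable [set w | Xs k w \in A].
  exact/measurable_fiber_pred/(run_measurable_state run).
rewrite unlock; under eq_integral => w _ do rewrite -sumEFin.
rewrite ge0_integral_sum//; last first.
  by move=> k; apply/measurable_EFinP; rewrite indicE; exact: measurable_indic.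
rewrite -sumEFin; apply: eq_bigr => k _.
have -> : (\int[P]_w ((Xs k w \in A)%:R%R : R)%:E)%E = P [set w | Xs k w \in A].
  rewrite -[X in P X]setIT -integral_indic//; apply: eq_integral => w _.
  by rewrite -[in RHS]indicE.
have -> : K = taboo_kernel finset.setT K.
  by apply/funext => x; apply/funext => y; rewrite /taboo_kernel finset.inE mul1r.
rewrite -(taboo_prob run); congr (P _); apply/seteqP; split=> w /=; last by case.
by move=> XA; split=> // j _; rewrite finset.inE.
Qed.

End Observables.

End Runs.

(** * The Markov chain induced by a randomized stationary policy *)

Section StepKernel.
Variables (R : realType) (X U : finType) (M : mdp R X U) (mu : X -> U -> R).
Hypothesis mu_rsp : is_rsp M mu.

(** At infeasible actions [trans] may be negative, but there the policy vanishes. *)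
Let mu_trans_ge0 x u y : 0 <= mu x u * trans M x u y.
Proof.
have [ux|ux] := boolP (u \in avail M x); last by rewrite (rsp_eq0 mu_rsp) ?mul0r.
by rewrite mulr_ge0 ?(trans_ge0 _ ux)// ltW ?(rsp_gt0 mu_rsp).
Qed.

Lemma step_kernel_ge0 x y : 0 <= step_kernel M mu x y.
Proof. exact: sumr_ge0. Qed.

Lemma step_kernel_sum1 x : \sum_y step_kernel M mu x y = 1.
Proof.
rewrite exchange_big -(rsp_sum1 mu_rsp x); apply: eq_bigr => u _.
rewrite -mulr_sumr; have [ux|ux] := boolP (u \in avail M x).
  by rewrite trans_sum1 ?mulr1.
by rewrite (rsp_eq0 mu_rsp) ?mul0r.
Qed.

Lemma step_kernel_gt0 x u y :
  u \in avail M x -> 0 < trans M x u y -> 0 < step_kernel M mu x y.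
Proof.
move=> ux pos; rewrite /step_kernel (bigD1 u)//=.
by rewrite ltr_wpDr ?sumr_ge0// mulr_gt0 ?(rsp_gt0 mu_rsp).
Qed.

Lemma step_kernel_absorbing x : absorbing M x -> step_kernel M mu x x = 1.
Proof.
case=> u avE tr1; have mu0 v : v != u -> mu x v = 0.
  by move=> vu; rewrite (rsp_eq0 mu_rsp)// avE finset.inE.
rewrite -(rsp_sum1 mu_rsp x) /step_kernel; apply: eq_bigr => v _.
by have [->|vu] := eqVneq v u; rewrite ?tr1 ?mulr1// mu0 ?mul0r.
Qed.

End StepKernel.

(** * Probability of avoiding the goal *)

Section Avoidance.
Variables (R : realType) (X U : finType) (M : mdp R X U) (mu : X -> U -> R).
Variable G : {set X}.
Hypothesis mu_rsp : is_rsp M mu.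

(** Probability that the run from [x] stays off [G] at times [0] to [n]: the taboo covers all times
    but the last, and the iterated indicator covers that one. *)
Definition avoid n : X -> R :=
  iter n (kernel_op (taboo_kernel (~: G) (step_kernel M mu)))
    (fun x => (x \in (~: G)%SET)%:R).

Lemma avoidS n x : x \notin G ->
  avoid n.+1 x = kernel_op (step_kernel M mu) (avoid n) x.
Proof.
move=> xG; rewrite /avoid iterS; apply: eq_bigr => y _.
by rewrite /taboo_kernel finset.inE xG mul1r.
Qed.

Lemma avoid_goal n x : x \in G -> avoid n x = 0.
Proof.
move=> xG; case: n => [|n]; first by rewrite /avoid/= finset.inE xG.
rewrite /avoid iterS /kernel_op big1// => y _.
by rewrite /taboo_kernel finset.inE xG !mul0r.
Qed.

Lemma avoid_le1 n x : avoid n x <= 1.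
Proof.
elim: n x => [|n IH] x; first by rewrite /avoid/= lern1 leq_b1.
have [xG|xG] := boolP (x \in G); first by rewrite avoid_goal.
rewrite avoidS//; apply: kernel_op_le1 => //.
  exact: step_kernel_ge0.
exact: step_kernel_sum1.
Qed.

Lemma avoid_ge0 n x : 0 <= avoid n x.
Proof.
apply: iter_kernel_op_ge0 => [z y|y]; last exact: ler0n.
by rewrite /taboo_kernel mulr_ge0 ?ler0n ?(step_kernel_ge0 mu_rsp).
Qed.

Definition avoid_lim x : R := limn (avoid^~ x).

Let taboo_ge0 x y : 0 <= taboo_kernel (~: G) (step_kernel M mu) x y.
Proof. by rewrite mulr_ge0 ?ler0n ?(step_kernel_ge0 mu_rsp). Qed.

(** Comparing horizons 1 and 0 is enough: monotonicity of the kernel carries the inequality to all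
    horizons. *)
Let taboo_decr x :
  kernel_op (taboo_kernel (~: G) (step_kernel M mu)) (fun x => (x \in (~: G)%SET)%:R) x
  <= (x \in (~: G)%SET)%:R.
Proof.
rewrite [leRHS]/= finset.inE; have [xG|xG] := boolP (x \in G).
  by rewrite [leLHS](avoid_goal 1 xG).
exact: (avoid_le1 1).
Qed.

Lemma avoid_cvg x : (avoid n x @[n --> \oo] --> avoid_lim x)%classic.
Proof. by apply: iter_kernel_op_cvg => // y; apply: ler0n. Qed.

Lemma avoid_lim_le n x : avoid_lim x <= avoid n x.
Proof.
apply: nonincreasing_cvgn_ge; last exact: avoid_cvg.
exact: iter_kernel_op_decr.
Qed.

Lemma avoid_lim_ge0 x : 0 <= avoid_lim x.
Proof.
by apply: limr_ge; [exact: avoid_cvg|apply: nearW => n; apply: avoid_ge0].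
Qed.

Lemma avoid_lim_goal x : x \in G -> avoid_lim x = 0.
Proof.
by move=> xG; apply/eqP; rewrite eq_le avoid_lim_ge0 andbT -(avoid_goal 0 xG) avoid_lim_le.
Qed.

(** First-step analysis, passed to the limit by [kernel_op_limn]. *)
Lemma avoid_lim_harmonic x : x \notin G ->
  kernel_op (step_kernel M mu) avoid_lim x = avoid_lim x.
Proof.
move=> xG; rewrite /avoid_lim /avoid -kernel_op_limn//; apply: eq_bigr => y _.
by rewrite /taboo_kernel finset.inE xG mul1r.
Qed.

Lemma avoid_absorbing n x : x \notin G -> absorbing M x -> avoid n x = 1.
Proof.
move=> xG xabs; elim: n => [|n IH]; first by rewrite /avoid/= finset.inE xG.
rewrite avoidS// (@kernel_op_dirac _ _ _ _ _ _ _ x)//.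
- exact: step_kernel_ge0.
- exact: step_kernel_sum1.
- exact: step_kernel_absorbing.
Qed.

Lemma plan_reach_ge0 us x : 0 <= plan_reach M G us x.
Proof.
elim: us x => [|u us IH] x /=; case: ifP => // _.
case: ifP => // ux; apply: sumr_ge0 => y _.
by rewrite mulr_ge0 ?(trans_ge0 _ ux).
Qed.

(** Induction along the plan: its first action has positive probability under [mu] and leads with
    positive probability to some [y] from which the rest of the plan can succeed. A mean of values
    at most 1, one of positive weight being strictly smaller, is below 1. *)
Lemma avoid_lt1 us x : 0 < plan_reach M G us x -> avoid (size us) x < 1.
Proof.
have [xG _|xG] := boolP (x \in G); first by rewrite avoid_goal.
elim: us x xG => [|u us IH] x xG; rewrite [plan_reach _ _ _ _]/= (negPf xG) ?ltxx//.
case: ifP => [ux|_]; last by rewrite ltxx.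
rewrite [size _]/= avoidS// => h.
have [y y_gt0] : exists y, 0 < trans M x u y * plan_reach M G us y.
  apply: contrapT => ny; move: h; rewrite big1 ?ltxx// => y _.
  apply/eqP; rewrite eq_le mulr_ge0 ?(trans_ge0 _ ux) ?plan_reach_ge0// andbT leNgt.
  by apply/negP => hy; apply: ny; exists y.
have tr0 := trans_ge0 y ux.
have tr_gt0 : 0 < trans M x u y.
  by rewrite lt_neqAle tr0 andbT; apply: contraTneq y_gt0 => <-; rewrite mul0r ltxx.
have avy : avoid (size us) y < 1.
  have [yG|yG] := boolP (y \in G); first by rewrite avoid_goal.
  by apply: IH => //; move: y_gt0; rewrite pmulr_rgt0.
rewrite -(step_kernel_sum1 mu_rsp x) /kernel_op (bigD1 y)// [ltRHS](bigD1 y)//=.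
apply: ltr_leD.
  by rewrite gtr_pMr// (step_kernel_gt0 mu_rsp ux).
by apply: ler_sum => z _; rewrite ler_piMr ?avoid_le1// (step_kernel_ge0 mu_rsp).
Qed.

End Avoidance.

(** * Comparison of the SSP chain with the original chain *)

Section Ssp.
Variables (R : realType) (X U : finType) (M : mdp R X U) (G B : {set X}).
Variables (x0 : {x : X | x \notin G}) (muM : X -> U -> R) (muS : ssp_state G -> U -> R).
Hypothesis GB_disjoint : [disjoint G & B].
Hypothesis unsafe_absorbing : forall x, x \in B -> absorbing M x.
Hypothesis muM_rsp : is_rsp M muM.
Hypothesis muS_rsp : is_rsp (ssp M B x0) muS.
Hypothesis muSM : same_policy B muS muM.

Let KM := step_kernel M muM.
Let KS := step_kernel (ssp M B x0) muS.
Let KS_ge0 := step_kernel_ge0 muS_rsp.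
Let KS_sum1 := step_kernel_sum1 muS_rsp.

Lemma sum_ssp_state (F : ssp_state G -> R) :
  \sum_y F y = F None + \sum_(y : {x | x \notin G}) F (Some y).
Proof.
rewrite (bigD1 None)//=; congr (_ + _).
rewrite (reindex_omap (Some : {y | y \notin G} -> ssp_state G) id) /=.
  by apply: eq_bigl => y; rewrite eqxx.
by case.
Qed.

(* [insub : X -> ssp_state G] collapses the goal states to the termination state. *)
Lemma ssp_kernel_op_safe f x : val x \notin B ->
  kernel_op KS f (Some x) = kernel_op KM (fun y => f (insub y)) (val x).
Proof.
move=> xB; rewrite /kernel_op sum_ssp_state [RHS](bigID (mem G))/=; congr (_ + _).
  rewrite {1}/KS /step_kernel /= (negPf xB).
  under eq_bigr do rewrite muSM// mulr_sumr.
  rewrite exchange_big mulr_suml; apply: eq_bigr => i iG.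
  by rewrite insubF ?iG.
rewrite [RHS](big_sub [pred y | y \notin G]).
apply: eq_bigr => y _; rewrite valK; congr (_ * _).
by apply: eq_bigr => u _; rewrite muSM//= (negPf xB).
Qed.

Lemma ssp_kernel_op_unsafe f x : val x \in B ->
  kernel_op KS f (Some x) = f (Some x0).
Proof.
move=> xB; apply: kernel_op_dirac => //.
rewrite -(rsp_sum1 muS_rsp (Some x)) /KS /step_kernel; apply: eq_bigr => u _.
by rewrite /= xB eqxx mulr1.
Qed.

Lemma ssp_kernel_None : KS None None = 1.
Proof.
by rewrite -(rsp_sum1 muS_rsp None); apply: eq_bigr => u _; rewrite /= mulr1.
Qed.

Definition ssp_unsafe : {set ssp_state G} :=
  [set y | if y is Some x then val x \in B else false]%SET.

Let r : R := 1 - avoid_lim M muM G (val x0).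

(* The probability of reaching the goal states in [M], as a function on the SSP;
   it is harmonic for the SSP except at unsafe states, where the restart adds [r]. *)
Let h (y : ssp_state G) : R :=
  1 - oapp (fun x => avoid_lim M muM G (val x)) 0 y.

Let cost t : R :=
  \sum_(k < t) iter k (kernel_op KS) (fun y => (y \in ssp_unsafe)%:R) (Some x0).

(** Disjointness keeps [x] out of [G], and the chain never leaves [x]. *)
Lemma avoid_lim_unsafe x : x \in B -> avoid_lim M muM G x = 1.
Proof.
move=> xB; have xG : x \notin G by move/disjointFl: GB_disjoint => ->.
apply/cvg_lim => //; rewrite [X in (X n @[n --> _])%classic](_ : _ = fun=> 1); first exact: cvg_cst.
by apply/funext => n; apply: avoid_absorbing => //; exact: unsafe_absorbing.
Qed.

Let kernel_op_h y : kernel_op KS h y = h y + r * (y \in ssp_unsafe)%:R.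
Proof.
case: y => [x|]; last first.
  by rewrite (kernel_op_dirac _ _ _ ssp_kernel_None)// finset.inE mulr0 addr0.
rewrite finset.inE; have [xB|xB] := boolP (val x \in B).
  by rewrite ssp_kernel_op_unsafe// mulr1 /h/= (avoid_lim_unsafe xB) subrr add0r.
rewrite mulr0 addr0 ssp_kernel_op_safe// /h /=.
(* Writing 1 as a row sum of the chain of [M] allows a termwise comparison; at goal states [insub]
   gives [None] and [avoid_lim] is 0. *)
rewrite -[in RHS](avoid_lim_harmonic muM_rsp (valP x)) -[X in _ = X - _](step_kernel_sum1 muM_rsp (val x)).
rewrite -sumrB; apply: eq_bigr => y _; rewrite mulrBr mulr1.
by case: insubP => [z _ <-//|]; rewrite negbK => yG /=; rewrite avoid_lim_goal.
Qed.

(** Step [t] adds [r] times the probability of being unsafe at time [t], and [h] equals [r] at the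
    start. *)
Lemma iter_kernel_op_h t : iter t (kernel_op KS) h (Some x0) = r * (1 + cost t).
Proof.
elim: t => [|t IH]; first by rewrite /cost big_ord0 addr0 mulr1.
rewrite iterSr.
have -> : kernel_op KS h = fun y => h y + r * (y \in ssp_unsafe)%:R.
  by apply/funext => y; exact: kernel_op_h.
by rewrite iter_kernel_op_linear IH /cost big_ord_recr/= addrA [RHS]mulrDr.
Qed.

Let ssp_avoid n (y : ssp_state G) : R :=
  iter n (kernel_op KS) (fun y => (y != None)%:R) y.

(** The two chains move alike at safe states. At an unsafe state the right-hand side is already 1,
    so the restart cannot break the bound. *)
Lemma ssp_avoid_le n x : ssp_avoid n (Some x) <= avoid M muM G n (val x).
Proof.
have None0 m : ssp_avoid m None = 0.
  elim: m => [|m IH]; first by [].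
  by rewrite /ssp_avoid iterS (kernel_op_dirac _ _ _ ssp_kernel_None).
elim: n x => [|n IH] x; first by rewrite /avoid/= finset.inE (valP x).
have [xB|xB] := boolP (val x \in B).
  rewrite avoid_absorbing ?(valP x)//; last exact: unsafe_absorbing.
  elim: (n.+1) (Some x) => [|m IHm] y; first by rewrite /ssp_avoid/= lern1 leq_b1.
  exact: kernel_op_le1.
rewrite avoidS ?(valP x)// /ssp_avoid iterS ssp_kernel_op_safe//.
apply: kernel_op_le => [y|y]; first exact: step_kernel_ge0.
case: insubP => [z _ <-|]; first exact: IH.
by rewrite negbK => yG; rewrite [leLHS]None0 avoid_ge0.
Qed.

Hypothesis x0_safe : val x0 \notin B.
Hypothesis safe_reach :
  forall x, x \notin B -> exists us : seq U, 0 < plan_reach M G us x.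

Lemma reach_gt0 : 0 < r.
Proof.
have [us /(avoid_lt1 muM_rsp) h1] := safe_reach x0_safe.
by rewrite subr_gt0 (le_lt_trans _ h1)// avoid_lim_le.
Qed.

Lemma ssp_avoid_cvg : (ssp_avoid n (Some x0) @[n --> \oo] --> 0)%classic.
Proof.
apply: absorption_cvg => //; first exact: ssp_kernel_None.
have lt1 x : val x \notin B -> exists n, ssp_avoid n (Some x) < 1.
  move=> xB; have [us /(avoid_lt1 muM_rsp) h1] := safe_reach xB.
  by exists (size us); apply: le_lt_trans (ssp_avoid_le _ _) h1.
case=> [x|]; last by exists 0%N; rewrite /= ltr01.
have [xB|/lt1//] := boolP (val x \in B).
have [n n1] := lt1 x0 x0_safe.
(* One extra step pays for the restart at the safe state [x0]. *)
by exists n.+1; rewrite iterS ssp_kernel_op_unsafe.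
Qed.

Lemma cost_cvg : (cost t @[t --> \oo] --> r^-1 - 1)%classic.
Proof.
have r0 := reach_gt0.
have rc : (r * (1 + cost t) @[t --> \oo] --> (1 : R))%classic.
  apply: (@squeeze_cvgr _ _ _ _ (fun t => 1 - ssp_avoid t (Some x0)) (fun=> 1)).
  - apply: nearW => t; rewrite -iter_kernel_op_h; apply/andP; split.
      (* Both bounds come from iterating a pointwise one: [h] lies between the indicator of [None]
         and 1. *)
      rewrite -(iter_kernel_op1 KS_sum1 t (Some x0)) -mulN1r -iter_kernel_op_linear.
      apply: iter_kernel_op_le => // -[x|] /=; last by rewrite mulr0 addr0 /h subr0.
      rewrite mulr1 subrr /h /= subr_ge0; apply: le_trans (avoid_le1 G muM_rsp 0 (val x)).
      exact: avoid_lim_le.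
    rewrite -(iter_kernel_op1 KS_sum1 t (Some x0)); apply: iter_kernel_op_le => // y.
    rewrite /h gerBl; case: y => [x|] //=; exact: avoid_lim_ge0.
  - by have := cvgB (@cvg_cst _ (1 : R) _ _ _) ssp_avoid_cvg; rewrite subr0; apply.
  - exact: cvg_cst.
(* Since [r] is positive, the affine relation can be solved for the cost. *)
have -> : cost = fun t => r^-1 * (r * (1 + cost t)) - 1.
  by apply/funext => t; rewrite mulKf ?gt_eqF// addrAC subrr add0r.
apply: cvgB; last exact: cvg_cst.
by have := cvgMl_tmp (a := r^-1) rc; rewrite mulr1; apply.
Qed.

End Ssp.

(** * Reach probability in terms of total cost *)

Theorem mainTheorem2 (R : realType) (X U : finType) (M : mdp R X U)
  (G B : {set X}) (x0 : {x : X | x \notin G})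
  (GB_disjoint : [disjoint G & B])
  (unsafe_absorbing : forall x, x \in B -> absorbing M x)
  (safe_reach : forall x, x \notin B -> exists us : seq U, 0 < plan_reach M G us x)
  (muM : X -> U -> R) (muS : ssp_state G -> U -> R)
  (muM_rsp : is_rsp M muM) (muS_rsp : is_rsp (ssp M B x0) muS)
  (muSM : same_policy B muS muM)
  (dM : measure_display) (TM : measurableType dM) (PM : probability TM R)
  (XM : nat -> TM -> X) (UM : nat -> TM -> U)
  (runM : is_run M muM (val x0) PM XM UM)
  (dS : measure_display) (TS : measurableType dS) (PS : probability TS R)
  (XS : nat -> TS -> ssp_state G) (US : nat -> TS -> U)
  (runS : is_run (ssp M B x0) muS (Some x0) PS XS US) :
  reach_prob PM XM G = (1 / (total_cost PS XS US (ssp_cost R U B) + 1))%E.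
Proof.
have -> : reach_prob PM XM G = (1 - avoid_lim M muM G (val x0))%:E.
  have cr := @reach_prob_cvg _ _ _ _ _ _ _ _ _ _ _ runM G.
  rewrite -(cvg_lim _ cr)//; apply/cvg_lim => //.
  apply: cvg_EFin; first exact: nearW.
  by apply: cvgB; [exact: cvg_cst|exact: (@avoid_cvg _ _ _ _ _ G muM_rsp)].
(* The cost does not depend on the action and is the indicator of [ssp_unsafe], so the expected cost
   counts expected visits. *)
have costE t : ('E_PS[fun w => (\sum_(k < t) ssp_cost R U B (XS k w) (US k w))%R])%E =
  (\sum_(k < t) iter k (kernel_op (step_kernel (ssp M B x0) muS))
     (fun y => (y \in ssp_unsafe G B)%:R) (Some x0))%:E.
  rewrite -(expected_visits runS); congr (expectation _ _); apply/funext => w.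
  by apply: eq_bigr => k _; rewrite finset.inE; case: (XS k w).
have [x0B|x0B] := boolP (val x0 \in B); last first.
  have r_gt0 := reach_gt0 muM_rsp x0B safe_reach.
  have := cost_cvg GB_disjoint unsafe_absorbing muM_rsp muS_rsp muSM x0B safe_reach.
  set c := (X in (X t @[t --> _] --> _)%classic) => cc.
  have -> : total_cost PS XS US (ssp_cost R U B) =
      ((1 - avoid_lim M muM G (val x0))^-1 - 1)%:E.
    apply/cvg_lim => //; rewrite (_ : (fun t => _) = (fun t => (c t)%:E)).
      by apply: cvg_EFin; [exact: nearW|exact: cc].
    by apply/funext.
  by rewrite div1e -EFinD subrK inver invr_eq0 gt_eqF// invrK.
(* With [x0] unsafe the run restarts at [x0] forever and pays 1 at every step; the inverse of [+oo]
   is then 0, matching a zero reach probability. *)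
have -> : total_cost PS XS US (ssp_cost R U B) = +oo%E.
  apply/cvg_lim => //; rewrite (_ : (fun t => _) = (fun t => t%:R%:E)).
    exact/cvgenyP.
  apply/funext => t; rewrite costE; congr EFin.
  transitivity (\sum_(k < t) (1 : R)); last by rewrite sumr_const card_ord.
  apply: eq_bigr => k _.
  elim: (k : nat) => [|j IH]; first by rewrite /= finset.inE x0B.
  by rewrite iterS (ssp_kernel_op_unsafe muS_rsp).
by rewrite div1e (avoid_lim_unsafe GB_disjoint unsafe_absorbing muM_rsp x0B) subrr.
Qed.
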